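(* Let $n\ge 3$, let $M$ be an $n$-dimensional manifold with coordinates $(x^1,\dots,x^n)$ and induced tangent bundle coordinates $(x^i,y^i)$, let $f=f(x^1)$ be a positive smooth function whose derivative $f'$ is not identically zero, let $(c_{\lambda\mu})_{2\le\lambda,\mu\le n}$ be a non-singular symmetric matrix of real constants, and put $$\beta=f(x^1)\,y^1,\qquad \alpha=f(x^1)\sqrt{(y^1)^2+\varphi},\qquad \varphi=\sum_{\lambda,\mu=2}^n c_{\lambda\mu}y^\lambda y^\mu .$$ For a real constant $a$ consider $$F=a\beta+\frac{\alpha^2-\beta^2}{a\beta+2\sqrt{\alpha^2-\beta^2}}.$$ If $a\neq 0$, then $F$ is a (non-regular) Landsberg metric which is not Berwaldian, and the coefficients of its geodesic spray are $$G^1=\left(\frac{2f(x^1)^2(y^1)^2-\alpha^2}{2f(x^1)^2}+\frac{a^2-2}{2a^2}\,\frac{\alpha^2-\beta^2}{f(x^1)^2}\right)\frac{f'(x^1)}{f(x^1)},\qquad G^\mu=P\,y^\mu\quad(\mu=2,\dots,n),$$ where $$P=\left(y^1+\frac{3}{2a f(x^1)}\sqrt{\alpha^2-\beta^2}\right)\frac{f'(x^1)}{f(x^1)}.$$ Moreover, when $a=0$ the metric is singular, i.e. $\det(g_{ij})=0$.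
   Context: Finsler metrics here are non-regular: $F=F(x,y)$ is a function, positively homogeneous of degree $1$ in $y$, considered only on the conic open subset of $TM\setminus\{0\}$ where its defining expression is defined, smooth and nonzero (in particular $\alpha^2-\beta^2>0$), and whose metric tensor $g_{ij}=\frac12\frac{\partial^2F^2}{\partial y^i\partial y^j}$ is non-degenerate there; no definiteness is required (nor for the quadratic form $\alpha^2$). With $(g^{ij})$ the inverse of $(g_{ij})$, the geodesic spray of $F$ is $S=y^i\frac{\partial}{\partial x^i}-2G^i\frac{\partial}{\partial y^i}$ with coefficients $$G^i=\tfrac14 g^{ih}\left(y^r\frac{\partial^2F^2}{\partial x^r\partial y^h}-\frac{\partial F^2}{\partial x^h}\right).$$ The Berwald tensor is $G^h_{ijk}=\frac{\partial^3G^h}{\partial y^i\partial y^j\partial y^k}$ and the Landsberg tensor is $L_{ijk}=-\frac12F\,\ell_h\,G^h_{ijk}$, where $\ell_h=\frac{\partial F}{\partial y^h}$. $F$ is Landsberg if $L_{ijk}\equiv 0$ and Berwald (Berwaldian) if $G^h_{ijk}\equiv0$. Repeated indices are summed.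
   Formalization: The matrix (c_{λμ}) is additionally assumed not to be negative definite (φ takes a positive value somewhere); for negative definite c one has α²−β² ≤ 0 everywhere, so F is defined nowhere and ''not Berwaldian'' fails. *)

(* Defs.v *)
From mathcomp Require Import all_boot all_order all_algebra.
From mathcomp Require Import all_classical all_reals all_analysis.

Set Implicit Arguments.
Unset Strict Implicit.
Unset Printing Implicit Defensive.

Import Order.TTheory GRing.Theory Num.Theory.
Import numFieldNormedType.Exports.

Local Open Scope classical_set_scope.
Local Open Scope ring_scope.

(** A manifold with global coordinates [(x^1,...,x^n)] is identified with an
    open subset of [R^n], and its tangent bundle with pairs [p = (x, y)] of row
    vectors: [p.1] is the base point and [p.2] the direction.  The dimension is
    [n = m.+1]: the coordinate index [1] is [ord0], and the indices [2..n] are the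
    [lift ord0 mu] for [mu : 'I_m]. *)
Notation TR R m := ('rV[R]_m.+1 * 'rV[R]_m.+1)%type.

Section Finsler.
Variables (R : realType) (m : nat).
Implicit Types (D : set (TR R m)) (F : TR R m -> R) (i j k h r : 'I_m.+1).

Definition partial_x i F : TR R m -> R :=
  'D_((delta_mx 0 i, 0) : TR R m) F.

Definition partial_y i F : TR R m -> R :=
  'D_((0, delta_mx 0 i) : TR R m) F.

(** [inl i] stands for the derivation in [x^i], [inr i] for that in [y^i]. *)
Definition partial (v : 'I_m.+1 + 'I_m.+1) F : TR R m -> R :=
  match v with inl i => partial_x i F | inr i => partial_y i F end.

(** C^infinity on [D] (meant for [D] open): all iterated partial derivatives
    are (Frechet) differentiable at every point of [D]. *)
Definition smooth_on D F : Prop :=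
  forall (s : seq ('I_m.+1 + 'I_m.+1)) p, D p ->
    differentiable (foldr partial F s) p.

Definition energy F : TR R m -> R := fun p => F p ^+ 2.

Definition metric_tensor F (p : TR R m) : 'M[R]_m.+1 :=
  \matrix_(i, j) (2^-1 * partial_y i (partial_y j (energy F)) p).

(** Non-regular Finsler metric over [M], with conic domain [D]. *)
Definition finsler_metric (M : set 'rV[R]_m.+1) D F : Prop :=
  [/\ open D,
      forall p, D p -> M p.1 /\ p.2 != 0,
      forall x y t, D (x, y) -> 0 < t ->
        D (x, t *: y) /\ F (x, t *: y) = t * F (x, y),
      smooth_on D F
    & forall p, D p -> F p != 0 /\ \det (metric_tensor F p) != 0].

Definition spray_coef F i (p : TR R m) : R :=
  4^-1 * \sum_h invmx (metric_tensor F p) i h *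
    (\sum_r p.2 0 r * partial_x r (partial_y h (energy F)) p
     - partial_x h (energy F) p).

Definition berwald_tensor F h i j k : TR R m -> R :=
  partial_y i (partial_y j (partial_y k (spray_coef F h))).

Definition landsberg_tensor F i j k (p : TR R m) : R :=
  - 2^-1 * F p * \sum_h partial_y h F p * berwald_tensor F h i j k p.

Definition is_landsberg D F : Prop :=
  forall p, D p -> forall i j k, landsberg_tensor F i j k p = 0.

Definition is_berwald D F : Prop :=
  forall p, D p -> forall h i j k, berwald_tensor F h i j k p = 0.

End Finsler.

Section Example.
Variables (R : realType) (m : nat).
Variables (f : R -> R) (c : 'M[R]_m) (a : R).

Definition phi (y : 'rV[R]_m.+1) : R :=
  \sum_(la < m) \sum_(mu < m) c la mu * y 0 (lift ord0 la) * y 0 (lift ord0 mu).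

Definition beta (p : TR R m) : R := f (p.1 0 ord0) * p.2 0 ord0.

Definition alpha (p : TR R m) : R :=
  f (p.1 0 ord0) * Num.sqrt (p.2 0 ord0 ^+ 2 + phi p.2).

Definition metricF (p : TR R m) : R :=
  a * beta p + (alpha p ^+ 2 - beta p ^+ 2) /
    (a * beta p + 2 * Num.sqrt (alpha p ^+ 2 - beta p ^+ 2)).

(** Where the expression of [metricF] is defined, smooth and nonzero.  Since
    [Num.sqrt] vanishes on negative numbers, [alpha ^+ 2 - beta ^+ 2 > 0]
    also forces the radicand of [alpha] to be positive (for [f <> 0]). *)
Definition metricF_domain (M : set 'rV[R]_m.+1) : set (TR R m) :=
  [set p | [/\ M p.1, p.2 != 0, 0 < alpha p ^+ 2 - beta p ^+ 2,
     a * beta p + 2 * Num.sqrt (alpha p ^+ 2 - beta p ^+ 2) != 0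
   & metricF p != 0]].

Definition sprayP (p : TR R m) : R :=
  let x1 := p.1 0 ord0 in
  (p.2 0 ord0 + 3 / (2 * a * f x1) * Num.sqrt (alpha p ^+ 2 - beta p ^+ 2))
  * (derive1 f x1 / f x1).

Definition sprayG1 (p : TR R m) : R :=
  let x1 := p.1 0 ord0 in
  ((2 * f x1 ^+ 2 * p.2 0 ord0 ^+ 2 - alpha p ^+ 2) / (2 * f x1 ^+ 2)
   + (a ^+ 2 - 2) / (2 * a ^+ 2)
     * ((alpha p ^+ 2 - beta p ^+ 2) / f x1 ^+ 2))
  * (derive1 f x1 / f x1).

End Example.

(* Main.v *)
Require Import Defs.
From mathcomp Require Import all_boot all_order all_algebra.
From mathcomp Require Import all_classical all_reals all_analysis.
From mathcomp Require Import ring lra.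
Import Order.TTheory GRing.Theory Num.Theory.
Import numFieldNormedType.Exports.
Local Open Scope classical_set_scope.
Local Open Scope ring_scope.
Set Implicit Arguments.
Unset Strict Implicit.
Unset Printing Implicit Defensive.

(** The metric depends on [x] only through the factor [f(x^1)], and on [y] only
    through [u = y^1] and [s = sqrt phi]: its defining expression collapses to
    [F = f (a u + s)^2 / (a u + 2 s)].  Write [K = (a u + s) / (a u + 2 s)],
    [C] for the matrix [c] bordered by a zero row and column, and [w = C y].
    The energy [E = F^2] then has the short gradient
    [E_i = f^2 K^3 (2 a (a u + 3 s) delta_i1 + 4 w_i)]  ([partial_y_energy]),
    hence a Hessian in which [K] contributes a rank one term
    ([metricE]).

    Non-degeneracy.  The derivative of the 0-homogeneous [K] kills [y].
    So if [z] is in the kernel of the Hessian, pairing with [y] shows that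
    [2 a (a u + 3 s) z_1 + 4 <w, z> = 0], the rank one term disappears, the
    first row gives [2 a^2 z_1 = 0], and what remains is [C z = 0]
    ([metric_det_neq0]).  For [a = 0] the first row of the Hessian is zero
    ([metric_det0]).

    Spray.  Instead of inverting [g], one multiplies the claimed vector
    [G = (f'/f) ((u + 3 s / (2 a)) y - (a u + s) (a u + 2 s) / (2 a^2) e_1)]
    by [g] and compares with the right-hand side of the definition
    ([spray_coefE]).

    Landsberg and Berwald.  Up to quadratic polynomials in [y], [G^h] is
    [(f'/f) (3 / (2 a)) s z^h] where [z = y - u e_1].  Third derivatives of
    [s z^h] involve only the second and third derivatives of [s].  The covector
    [F_h] pairs with [z] and its derivatives like a multiple of [w], so the
    Landsberg tensor is a multiple of the third derivative of [s s = phi],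
    a quadratic form: it vanishes ([metricF_landsberg]).  The trace of the
    Berwald tensor is [(f'/f) (3 / (2 a)) n s_jk] ([berwald_trace]), and
    [s_jk = 0] would force [c] to have rank one, impossible for an invertible
    matrix of size [n - 1 >= 2] ([rootH_neq0]). *)

(** * Directional derivatives and differentiability *)

Section Calculus.
Variables (R : realType) (V : normedModType R).
Implicit Types (F G : V -> R) (p v : V).

(** Differentiability is a local property; it is what allows a function to be
    replaced by a formula valid only on an open domain. *)
Lemma differentiable_near F G p :
  (\near p, F p = G p) -> differentiable F p -> differentiable G p.
Proof.
move=> FG dF.
have FGp : F p = G p by exact: nbhs_singleton FG.
have [dc /eqaddoP eF] := (diff_locallyP _ _).1 dF.
have eG : G \o shift p = cst (G p) + 'd F p +o_ (0 : V) (@id V).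
  apply/eqaddoP => eps eps0.
  have FG0 : \forall h \near 0, F (h + p) = G (h + p).
    by move: FG; rewrite (near_shift 0) /= subr0.
  move: (eF eps eps0) FG0; apply: filter_app2; near=> h => /= + FGh.
  by rewrite /shift !fctE /= FGh FGp.
apply/diff_locallyP; rewrite (diff_unique dc eG) //.
Unshelve. all: by end_near. Qed.

Lemma derive_line F p v :
  'D_v F p = 'D_1 (fun h : R => F (h *: v + p)) 0.
Proof.
rewrite /derive; set g1 := fun h => h^-1 *: _; set g2 := fun h => h^-1 *: _.
suff -> : g1 = g2 by []; apply/funext => h; rewrite /g1 /g2 /=.
by rewrite addr0 scale0r add0r [_%:A]mulr1.
Qed.

(** Along the line [h |-> p + h v] this is the chain rule for functions of one
    real variable. *)
Lemma is_derive_comp1 (g : R -> R) F p v (dF : R) :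
  derivable g (F p) 1 -> is_derive p v F dF ->
  is_derive p v (fun q => g (F q)) (derive1 g (F p) * dF).
Proof.
move=> dg [dvF <-].
pose L := fun h : R => F (h *: v + p).
have L0 : L 0 = F p by rewrite /L scale0r add0r.
have dL : derivable L 0 1 by apply: (derivable1P _ _ _).1.
have dgL : derivable g (L 0) 1 by rewrite L0.
have dLd := (derivable1_diffP _ _).1 dL.
have dgLd := (derivable1_diffP _ _).1 dgL.
apply: DeriveDef.
  apply: (derivable1P _ _ _).2; apply: (derivable1_diffP _ _).2.
  exact: differentiable_comp dLd dgLd.
have -> : 'D_v (fun q => g (F q)) p = derive1 (g \o L) 0.
  by rewrite derive1E; exact: derive_line.
have -> : 'D_v F p = derive1 L 0 by rewrite derive1E; exact: derive_line.
by rewrite (derive1_comp dL dgL) L0.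
Qed.

Lemma is_derive_mul F G p v (dF dG : R) :
  is_derive p v F dF -> is_derive p v G dG ->
  is_derive p v (fun q => F q * G q) (dF * G p + F p * dG).
Proof.
move=> hF hG; apply: (@is_derive_eq _ _ _ _ _ _ _ _ (is_deriveM hF hG)).
by rewrite addrC mulrC.
Qed.

Lemma is_derive_scale F p v (r dF : R) :
  is_derive p v F dF -> is_derive p v (fun q => r * F q) (r * dF).
Proof. exact: is_deriveZ. Qed.

Lemma is_derive_add F G p v (dF dG : R) :
  is_derive p v F dF -> is_derive p v G dG ->
  is_derive p v (fun q => F q + G q) (dF + dG).
Proof. move=> hF hG; exact: is_deriveD. Qed.

Lemma is_derive_inv F p v (dF : R) : F p != 0 ->
  is_derive p v F dF -> is_derive p v (fun q => (F q)^-1) (- dF / F p ^+ 2).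
Proof.
move=> Fp [hF <-]; apply: DeriveDef; first exact: derivableV.
by rewrite deriveV// [LHS]mulrC mulrN mulNr.
Qed.

Lemma is_derive_bigsum n (h : 'I_n -> V -> R) p v (dh : 'I_n -> R) :
  (forall i, is_derive p v (h i) (dh i)) ->
  is_derive p v (fun q => \sum_i h i q) (\sum_i dh i).
Proof.
move=> H; rewrite (_ : (fun q => _) = \sum_i h i); first exact: is_derive_sum.
by apply/funext => q; rewrite fct_sumE.
Qed.

Lemma is_derive_near F G p v (dF : R) :
  (\near p, F p = G p) -> is_derive p v F dF -> is_derive p v G dF.
Proof. exact: near_eq_is_derive. Qed.
End Calculus.

(** * Coordinate functions on the tangent bundle *)

Section Coordinates.
Variables (R : realType) (m : nat).
Implicit Types (p v : TR R m) (i k : 'I_m.+1).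

Definition dir (d : 'I_m.+1 + 'I_m.+1) : TR R m :=
  match d with inl i => (delta_mx 0 i, 0) | inr i => (0, delta_mx 0 i) end.

Lemma partialE d (F : TR R m -> R) : partial d F = 'D_(dir d) F.
Proof. by case: d. Qed.

Lemma partial_x_val i (F : TR R m -> R) p d :
  is_derive p (delta_mx 0 i, 0) F d -> partial_x i F p = d.
Proof. by case. Qed.

Lemma partial_y_val i (F : TR R m -> R) p d :
  is_derive p (0, delta_mx 0 i) F d -> partial_y i F p = d.
Proof. by case. Qed.

Lemma differentiable_y i p : differentiable (fun q : TR R m => q.2 0 i) p.
Proof.
have @L : {linear TR R m -> R}.
  by exists (fun q : TR R m => q.2 0 i); do 2![eexists]; do ?[constructor];
     rewrite ?mxE// => ? *; rewrite ?mxE//; move=> ?; rewrite !mxE.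
apply: (@linear_differentiable _ _ _ L) => q.
exact: (cvg_comp (@snd _ _) (fun N : 'rV[R]_m.+1 => N 0 i)
  (@cvg_snd _ _ _ _ _) (@coord_continuous R _ _ 0 i q.2)).
Qed.

Lemma differentiable_x i p : differentiable (fun q : TR R m => q.1 0 i) p.
Proof.
have @L : {linear TR R m -> R}.
  by exists (fun q : TR R m => q.1 0 i); do 2![eexists]; do ?[constructor];
     rewrite ?mxE// => ? *; rewrite ?mxE//; move=> ?; rewrite !mxE.
apply: (@linear_differentiable _ _ _ L) => q.
exact: (cvg_comp (@fst _ _) (fun N : 'rV[R]_m.+1 => N 0 i)
  (@cvg_fst _ _ _ _ _) (@coord_continuous R _ _ 0 i q.1)).
Qed.

(** The difference quotient of a function affine along [v] is constant. *)
Lemma is_derive_lin (L : TR R m -> R) p v :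
  (forall h q, L (h *: v + q) = h * L v + L q) -> is_derive p v L (L v).
Proof.
move=> Ll; have E : {near (0 : R)^', (fun=> L v) =1
    (fun h => h^-1 *: ((L \o shift p) (h *: v) - L p))}.
  near=> h; rewrite /= Ll addrK /GRing.scale/= mulKf//.
  by near: h; exact: nbhs_dnbhs_neq.
have C : (fun h => h^-1 *: ((L \o shift p) (h *: v) - L p)) @ (0 : R)^' --> L v.
  exact: (cvg_trans (near_eq_cvg E) (cvg_cst _)).
apply: DeriveDef; first by apply/cvg_ex; exists (L v).
exact: cvg_lim C.
Unshelve. all: by end_near. Qed.

Lemma is_derive_y i p v : is_derive p v (fun q : TR R m => q.2 0 i) (v.2 0 i).
Proof. by apply: is_derive_lin => h q; rewrite !mxE. Qed.

Lemma is_derive_x i p v : is_derive p v (fun q : TR R m => q.1 0 i) (v.1 0 i).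
Proof. by apply: is_derive_lin => h q; rewrite !mxE. Qed.

End Coordinates.

(** * Smoothness of elementary expressions *)

Section Elementary.
Variables (R : realType) (m : nat) (f : R -> R) (D : set (TR R m)).
Implicit Types (F G : TR R m -> R).
Hypothesis D_open : open D.
Hypothesis f_smooth :
  forall p, D p -> forall k, derivable (derive1n k f) (p.1 0 ord0) 1.

(** Functions built from constants, fibre coordinates, the derivatives of [f]
    at [x^1] and operations that are smooth on [D].  The derivatives of [f] of
    all orders are included so that the class is stable under partial
    derivatives. *)
Inductive elementary : (TR R m -> R) -> Prop :=
| elem_cst r : elementary (fun=> r)
| elem_y i : elementary (fun p => p.2 0 i)
| elem_f k : elementary (fun p => derive1n k f (p.1 0 ord0))
| elem_add F G : elementary F -> elementary G -> elementary (fun p => F p + G p)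
| elem_mul F G : elementary F -> elementary G -> elementary (fun p => F p * G p)
| elem_inv F : elementary F -> (forall p, D p -> F p != 0) ->
    elementary (fun p => (F p)^-1)
| elem_sqrt F : elementary F -> (forall p, D p -> 0 < F p) ->
    elementary (fun p => Num.sqrt (F p)).

Lemma elementary_differentiable F p :
  elementary F -> D p -> differentiable F p.
Proof.
move=> EF; elim: EF p => [r|i|k|{}F G _ IF _ IG|{}F G _ IF _ IG
    |{}F _ IF F0|{}F _ IF F0] p Dp.
- exact: differentiable_cst.
- exact: differentiable_y.
- apply: (@differentiable_comp _ _ _ _ (fun q : TR R m => q.1 0 ord0)
    (derive1n k f)).
    exact: differentiable_x.
  by apply/derivable1_diffP; exact: f_smooth.
- by apply: differentiableD; [exact: IF|exact: IG].
- by apply: differentiableM; [exact: IF|exact: IG].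
- by apply: differentiableV; [exact: IF|exact: F0].
- apply: (@differentiable_comp _ _ _ _ F Num.sqrt); first exact: IF.
  by apply/derivable1_diffP; have [] := is_derive1_sqrt (F0 p Dp).
Qed.

Lemma elementary_partial d F : elementary F ->
  exists2 G, elementary G & forall p, D p -> is_derive p (dir R d) F (G p).
Proof.
move=> EF; elim: EF => [r|i|k|{}F G EF [F' EF' IF] EG [G' EG' IG]
    |{}F G EF [F' EF' IF] EG [G' EG' IG]
    |{}F EF [F' EF' IF] F0|{}F EF [F' EF' IF] F0].
- by exists (fun=> 0) => [|p _]; [exact: elem_cst|exact: is_derive_cst].
- exists (fun=> (dir R d).2 0 i) => [|p _]; first exact: elem_cst.
  exact: is_derive_y.
- exists (fun p : TR R m => derive1n k.+1 f (p.1 0 ord0) * (dir R d).1 0 ord0).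
    by apply: elem_mul; [exact: elem_f|exact: elem_cst].
  move=> p Dp; rewrite derive1nS.
  by apply: is_derive_comp1; [exact: f_smooth|exact: is_derive_x].
- exists (fun p : TR R m => F' p + G' p) => [|p Dp]; first exact: elem_add.
  by apply: is_derive_add; [exact: IF|exact: IG].
- exists (fun p : TR R m => F' p * G p + F p * G' p) => [|p Dp].
    by apply: elem_add; apply: elem_mul.
  by apply: is_derive_mul; [exact: IF|exact: IG].
- exists (fun p : TR R m => (-1) * F' p * ((F p)^-1 * (F p)^-1)) => [|p Dp].
    apply: elem_mul; first by apply: elem_mul => //; exact: elem_cst.
    by apply: elem_mul; exact: elem_inv.
  apply: is_derive_eq (is_derive_inv (F0 p Dp) (IF p Dp)) _.
  by rewrite mulN1r expr2 invfM.
- exists (fun p : TR R m => (2 * Num.sqrt (F p))^-1 * F' p) => [|p Dp].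
    apply: elem_mul => //; apply: elem_inv.
      by apply: elem_mul; [exact: elem_cst|exact: elem_sqrt].
    by move=> p Dp; rewrite mulf_neq0 ?pnatr_eq0// gt_eqF// sqrtr_gt0 F0.
  have [ds es] := is_derive1_sqrt (F0 p Dp).
  by rewrite -es -derive1E; apply: is_derive_comp1 ds (IF p Dp).
Qed.

Lemma near_eq_in F G p : D p -> {in D, F =1 G} -> \near p, F p = G p.
Proof.
move=> Dp FG; near=> q; apply: FG; rewrite inE.
by near: q; apply: open_nbhs_nbhs; split.
Unshelve. all: by end_near. Qed.

(** Partial derivatives leave the class only outside [D]: every iterated partial
    derivative agrees with an elementary function on the open set [D], hence
    inherits its differentiability there. *)
Lemma elementary_smooth F G :
  elementary F -> {in D, F =1 G} -> smooth_on D G.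
Proof.
move=> EF FG s p Dp.
suff [H EH HE] : exists2 H, elementary H & {in D, H =1 foldr (@partial R m) G s}.
  apply: differentiable_near (near_eq_in Dp HE) _.
  exact: elementary_differentiable.
elim: s => [|d s [H EH HE]]; first by exists F.
have [H' EH' dH] := elementary_partial d EH.
exists H' => // q /[!inE] Dq /=; rewrite partialE.
by have [_ <-] := is_derive_near (near_eq_in Dq HE) (dH q Dq).
Qed.

Lemma elementary_open G (A : set R) :
  elementary G -> open A -> open [set p | D p /\ A (G p)].
Proof.
move=> EG oA; rewrite openE => p [Dp AG]; near=> q; split; near: q.
  by apply: open_nbhs_nbhs.
have /differentiable_continuous/(_ A) := elementary_differentiable EG Dp.
by apply; apply: open_nbhs_nbhs.
Unshelve. all: by end_near. Qed.

Lemma elem_sum n (F : 'I_n -> TR R m -> R) :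
  (forall i, elementary (F i)) -> elementary (fun p => \sum_i F i p).
Proof.
elim: n F => [F _|n IH F EF].
  rewrite (_ : (fun p => _) = fun=> 0); first exact: elem_cst.
  by apply/funext => p; rewrite big_ord0.
rewrite (_ : (fun p => _) =
    fun p => F ord0 p + \sum_(i < n) F (lift ord0 i) p).
  by apply: elem_add => //; apply: IH.
by apply/funext => p; rewrite big_ord_recl.
Qed.

End Elementary.

(** * The quadratic form on all coordinates *)

Section ExtendedForm.
Variables (R : realType) (m : nat) (c : 'M[R]_m).
Hypothesis c_sym : c^T = c.
Implicit Types (y z : 'rV[R]_m.+1) (i j k : 'I_m.+1).

(** The matrix [c] bordered by a zero first row and column, which lets every
    index range over all coordinates, without splitting off the first. *)
Definition extc i j : R :=
  if (unlift ord0 i, unlift ord0 j) is (Some la, Some mu) then c la mu else 0.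

Definition polar y i : R := \sum_j extc i j * y 0 j.

Definition delta1 i : R := (i == ord0)%:R.

Lemma extc_lift la mu : extc (lift ord0 la) (lift ord0 mu) = c la mu.
Proof. by rewrite /extc !liftK. Qed.

Lemma extc0l j : extc ord0 j = 0.
Proof. by rewrite /extc unlift_none. Qed.

Lemma extc0r i : extc i ord0 = 0.
Proof. by rewrite /extc unlift_none; case: unlift. Qed.

Lemma extc_sym i j : extc i j = extc j i.
Proof.
rewrite /extc; case: unlift => [la|]; case: unlift => [mu|] //.
by rewrite -c_sym mxE c_sym.
Qed.

Lemma polar0 y : polar y ord0 = 0.
Proof. by rewrite /polar big1// => j _; rewrite extc0l mul0r. Qed.

Lemma phi_polar y : phi c y = \sum_i polar y i * y 0 i.
Proof.
rewrite big_ord_recl polar0 mul0r add0r /phi; apply: eq_bigr => la _.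
rewrite /polar big_ord_recl extc0r mul0r add0r mulr_suml.
by apply: eq_bigr => mu _; rewrite extc_lift mulrAC.
Qed.

Lemma polar_zero i : polar 0 i = 0.
Proof. by rewrite /polar big1// => j _; rewrite mxE mulr0. Qed.

Lemma polarD h y z i : polar (h *: y + z) i = h * polar y i + polar z i.
Proof.
rewrite /polar mulr_sumr -big_split; apply: eq_bigr => j _.
by rewrite !mxE /=; ring.
Qed.

Lemma polar_sym y z : \sum_i polar y i * z 0 i = \sum_i polar z i * y 0 i.
Proof.
rewrite /polar; under eq_bigr do rewrite mulr_suml.
under [RHS]eq_bigr do rewrite mulr_suml.
rewrite exchange_big; apply: eq_bigr => j _; apply: eq_bigr => i _.
by rewrite extc_sym; ring.
Qed.

Lemma phiZ h y : phi c (h *: y) = h ^+ 2 * phi c y.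
Proof.
rewrite /phi mulr_sumr; apply: eq_bigr => i _; rewrite mulr_sumr.
by apply: eq_bigr => j _; rewrite !mxE; ring.
Qed.

Lemma sum_delta (F : 'I_m.+1 -> R) i : \sum_k F k * (k == i)%:R = F i.
Proof.
rewrite (bigD1 i)//= eqxx mulr1 big1 ?addr0// => k /negbTE ->.
by rewrite mulr0.
Qed.

Lemma polar_inj y : c \in unitmx -> y 0 ord0 = 0 ->
  (forall i, polar y i = 0) -> y = 0.
Proof.
move=> cU y0 wy; pose z : 'rV[R]_m := \row_mu y 0 (lift ord0 mu).
have : z *m c = 0.
  apply/rowP => la; rewrite !mxE -[RHS](wy (lift ord0 la)) /polar.
  rewrite big_ord_recl y0 mulr0 add0r; apply: eq_bigr => mu _.
  by rewrite extc_sym extc_lift mxE mulrC.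
move=> /(congr1 (mulmx^~ (invmx c))); rewrite mulmxK// mul0mx => z0.
apply/rowP => i; rewrite mxE; case: (unliftP ord0 i) => [mu|] ->//.
by have /rowP/(_ mu) := z0; rewrite !mxE.
Qed.

End ExtendedForm.

(** * The metric and its domain *)

Section Example.
Variables (R : realType) (m : nat) (f : R -> R) (c : 'M[R]_m) (a : R).
Variable (M : set 'rV[R]_m.+1).
Hypothesis M_open : open M.
Hypothesis f_smooth :
  forall x, M x -> forall k : nat, derivable (derive1n k f) (x 0 ord0) 1.
Hypothesis f_pos : forall x, M x -> 0 < f (x 0 ord0).
Hypothesis c_sym : c^T = c.
Implicit Types (p q v : TR R m) (i j k h : 'I_m.+1).

Notation C := (extc c).
Notation D := (metricF_domain f c a M).
Notation F := (metricF f c a).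
Notation del := (@delta1 R m).

Definition first_dir p : R := p.2 0 ord0.
Definition conf p : R := f (p.1 0 ord0).
Definition dconf p : R := derive1 f (p.1 0 ord0).
Definition root_phi p : R := Num.sqrt (phi c p.2).
Notation u := first_dir.
Notation X := conf.
Notation X' := dconf.
Notation s := root_phi.

(** In these variables the metric is [X * P ^+ 2 / Q]: the numerator of
    [metricF] over the common denominator is a perfect square. *)
Definition numer p : R := a * u p + s p.
Definition denom p : R := a * u p + 2 * s p.
Notation P := numer.
Notation Q := denom.
Notation w p i := (polar c p.2 i).

Lemma alphaBbeta p : 0 < X p -> 0 < phi c p.2 ->
  alpha f c p ^+ 2 - beta f p ^+ 2 = (X p * s p) ^+ 2.
Proof.
move=> X0 phi0; rewrite /alpha /beta -/(X p) -/(u p) !exprMn !sqr_sqrtr ?(ltW phi0)//.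
  by ring.
by rewrite addr_ge0 ?sqr_ge0// ltW.
Qed.

(** If the radicand of [alpha] were negative, [alpha] would vanish and
    [alpha^2 - beta^2] would be nonpositive. *)
Lemma phi_gt0 p : 0 < X p -> 0 < alpha f c p ^+ 2 - beta f p ^+ 2 ->
  0 < phi c p.2.
Proof.
move=> X0; rewrite /alpha /beta -/(X p) -/(u p) !exprMn -mulrBr pmulr_rgt0 ?exprn_gt0//.
have [h|h] := leP 0 (u p ^+ 2 + phi c p.2); first by rewrite sqr_sqrtr//; lra.
by rewrite ler0_sqrtr ?(ltW h)// expr0n/= sub0r oppr_gt0 ltNge sqr_ge0.
Qed.

Lemma root_phi_gt0 p : 0 < phi c p.2 -> 0 < s p.
Proof. by rewrite sqrtr_gt0. Qed.

Lemma sqr_root_phi p : 0 < phi c p.2 -> s p ^+ 2 = phi c p.2.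
Proof. by move=> ?; rewrite sqr_sqrtr// ltW. Qed.

Lemma sqrt_alphaBbeta p : 0 < X p -> 0 < phi c p.2 ->
  Num.sqrt (alpha f c p ^+ 2 - beta f p ^+ 2) = X p * s p.
Proof.
move=> X0 phi0; rewrite alphaBbeta// sqrtr_sqr.
by rewrite ger0_norm// mulr_ge0// ltW// root_phi_gt0.
Qed.

Lemma metricF_denomE p : a * beta f p + 2 * (X p * s p) = X p * Q p.
Proof. by rewrite /beta -/(X p) -/(u p) /Q; ring. Qed.

Lemma metricF_E p : 0 < X p -> 0 < phi c p.2 -> Q p != 0 ->
  F p = X p * (P p * P p * (Q p)^-1).
Proof.
move=> X0 phi0 Q0; rewrite /metricF sqrt_alphaBbeta// alphaBbeta// metricF_denomE.
have X0' : X p != 0 by rewrite gt_eqF.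
rewrite /beta -/(u p) -/(X p); move: Q0; rewrite /P /Q => Q0.
by field; rewrite X0' Q0.
Qed.

Lemma domainP p : D p <-> [/\ M p.1, 0 < phi c p.2, P p != 0 & Q p != 0].
Proof.
split=> [[Mp y0 ab0 q0 F0]|[Mp phi0 P0 Q0]]; have X0 := f_pos Mp; rewrite -/(X p) in X0.
  have phi0 := phi_gt0 X0 ab0.
  have Q0 : Q p != 0.
    by apply: contraNneq q0 => Q0; rewrite sqrt_alphaBbeta// metricF_denomE Q0 mulr0.
  split=> //; apply: contraNneq F0 => P0.
  by rewrite metricF_E// P0 !(mul0r, mulr0).
have sp := root_phi_gt0 phi0.
split=> //.
- by apply: contraTneq phi0 => ->; rewrite -(scale0r (0 : 'rV[R]_m.+1))
    phiZ expr0n mul0r ltxx.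
- by rewrite alphaBbeta// exprn_gt0// mulr_gt0.
- by rewrite sqrt_alphaBbeta// metricF_denomE mulf_neq0// gt_eqF.
- by rewrite metricF_E// !mulf_neq0 ?invr_eq0// gt_eqF.
Qed.

Lemma conf_gt0 p : D p -> 0 < X p. Proof. by move=> [/f_pos]. Qed.

Lemma metricF_domainE p : D p -> F p = X p * (P p * P p * (Q p)^-1).
Proof.
move=> Dp; have [_ ? _ ?] := (domainP p).1 Dp.
by apply: metricF_E => //; exact: conf_gt0.
Qed.

(* The domain is reached in two stages, since the square root is elementary
   only where [phi] is known to be positive. *)
Let TM := [set p : TR R m | M p.1].
Let MPhi := [set p : TR R m | TM p /\ 0 < phi c p.2].

Lemma TM_open : open TM.
Proof.
apply: open_comp M_open => p _; exact: cvg_fst.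
Qed.

Lemma TM_smooth p : TM p -> forall k : nat, derivable (derive1n k f) (p.1 0 ord0) 1.
Proof. exact: f_smooth. Qed.

Lemma elem_phi E : elementary f E (fun p => phi c p.2).
Proof.
apply: elem_sum => i; apply: elem_sum => j.
by apply: elem_mul; [apply: elem_mul; [exact: elem_cst|]|]; exact: elem_y.
Qed.

Lemma elem_root_phi E : (forall p, E p -> 0 < phi c p.2) -> elementary f E s.
Proof. by move=> ?; apply: elem_sqrt => //; exact: elem_phi. Qed.

Lemma elem_numer E : (forall p, E p -> 0 < phi c p.2) -> elementary f E P.
Proof.
move=> E0; apply: elem_add; last exact: elem_root_phi.
by apply: elem_mul; [exact: elem_cst|exact: elem_y].
Qed.

Lemma elem_denom E : (forall p, E p -> 0 < phi c p.2) -> elementary f E Q.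
Proof.
move=> E0; apply: elem_add; first by apply: elem_mul; [exact: elem_cst|exact: elem_y].
by apply: elem_mul; [exact: elem_cst|exact: elem_root_phi].
Qed.

Lemma MPhi_open : open MPhi.
Proof. 
have := elementary_open TM_open TM_smooth (elem_phi _).
by move=> /(_ [set r | 0 < r]); apply; exact: open_gt. Qed.

Lemma D_open : open D.
Proof.
have sm p : MPhi p -> forall k : nat, derivable (derive1n k f) (p.1 0 ord0) 1.
  by move=> [/TM_smooth].
have E0 p : MPhi p -> 0 < phi c p.2 by case.
have o0 : open [set r : R | r != 0] by exact: open_neq.
have oP := elementary_open MPhi_open sm (elem_numer E0) o0.
have oQ := elementary_open MPhi_open sm (elem_denom E0) o0.
rewrite (_ : D = [set p | MPhi p /\ P p != 0] `&` [set p | MPhi p /\ Q p != 0]).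
  exact: openI.
apply/seteqP; split=> p; first by move=> /domainP[].
by move=> [[[? ?] ?] [_ ?]]; apply/domainP.
Qed.

Lemma D_smooth p : D p -> forall k : nat, derivable (derive1n k f) (p.1 0 ord0) 1.
Proof. by move=> [/f_smooth]. Qed.

Lemma elem_metricF : elementary f D (fun p => X p * (P p * P p * (Q p)^-1)).
Proof.
have D0 p : D p -> 0 < phi c p.2 by move=> /domainP[].
apply: elem_mul; first exact: (elem_f _ _ 0).
apply: elem_mul; first by apply: elem_mul; exact: elem_numer.
by apply: elem_inv; [exact: elem_denom|move=> p /domainP[]].
Qed.

Lemma metricF_smooth : smooth_on D F.
Proof.
apply: (elementary_smooth D_open D_smooth elem_metricF) => p /[!inE] Dp.
by rewrite metricF_domainE.
Qed.

Lemma metricF_homogeneous x y t : D (x, y) -> 0 < t ->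
  D (x, t *: y) /\ F (x, t *: y) = t * F (x, y).
Proof.
move=> Dp t0; have [/= Mx phi0 P0 Q0] := (domainP _).1 Dp.
have st : s (x, t *: y) = t * s (x, y).
  by rewrite /s /= phiZ sqrtrM ?sqr_ge0// sqrtr_sqr gtr0_norm.
have ut : u (x, t *: y) = t * u (x, y) by rewrite /u /= mxE.
have Pt : P (x, t *: y) = t * P (x, y) by rewrite /P st ut; ring.
have Qt : Q (x, t *: y) = t * Q (x, y) by rewrite /Q st ut; ring.
have t0' : t != 0 by rewrite gt_eqF.
have Dt : D (x, t *: y).
  apply/domainP; split=> //=; rewrite ?phiZ ?Pt ?Qt ?mulf_neq0//.
  by rewrite mulr_gt0// exprn_gt0.
split=> //; rewrite !metricF_domainE// Pt Qt /X /=; field.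
by rewrite Q0.
Qed.

(** * First and second derivatives of the energy *)

Definition bilin p v : R := \sum_i w p i * v.2 0 i.

Lemma is_derive_u p v : is_derive p v u (u v).
Proof. exact: is_derive_y. Qed.

Lemma is_derive_w p v i : is_derive p v (fun q => w q i) (w v i).
Proof. by apply: is_derive_lin => h q; rewrite /= polarD. Qed.

Lemma is_derive_X p v : M p.1 -> is_derive p v X (X' p * v.1 0 ord0).
Proof.
move=> Mp; have df : derivable f (p.1 0 ord0) 1 := @f_smooth _ Mp 0.
exact: is_derive_comp1 df (is_derive_x ord0 p v).
Qed.

Lemma is_derive_phi p v : is_derive p v (fun q => phi c q.2) (2 * bilin p v).
Proof.
rewrite (_ : (fun q => _) = fun q : TR R m => \sum_i w q i * q.2 0 i); last first.
  by apply/funext => q; rewrite phi_polar.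
have := is_derive_bigsum (fun i =>
  is_derive_mul (is_derive_w p v i) (is_derive_y i p v)).
move/is_derive_eq; apply; rewrite big_split /= polar_sym// -/(bilin p v).
by rewrite mulrDl mul1r.
Qed.

Lemma is_derive_s p v : 0 < phi c p.2 -> is_derive p v s (bilin p v / s p).
Proof.
move=> phi0; have [ds es] := is_derive1_sqrt phi0.
have := is_derive_comp1 (F := fun q : TR R m => phi c q.2) ds (is_derive_phi p v).
move/is_derive_eq; apply.
have := root_phi_gt0 phi0; rewrite derive1E es -/(s p) => s0.
have s0' : s p != 0 by rewrite gt_eqF.
by field.
Qed.

Lemma is_derive_P p v : 0 < phi c p.2 ->
  is_derive p v P (a * u v + bilin p v / s p).
Proof.
move=> phi0; apply: is_derive_add; last exact: is_derive_s.
exact: is_derive_scale (is_derive_u p v).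
Qed.

Lemma is_derive_Q p v : 0 < phi c p.2 ->
  is_derive p v Q (a * u v + 2 * (bilin p v / s p)).
Proof.
move=> phi0; apply: is_derive_add.
  exact: is_derive_scale (is_derive_u p v).
exact: is_derive_scale (is_derive_s v phi0).
Qed.

Definition ratio p : R := P p / Q p.
Notation K := ratio.

(** The derivative of [K] is proportional to [s du - u ds], so it vanishes in
    the direction of [y]. *)
Lemma is_derive_ratio p v : 0 < phi c p.2 -> Q p != 0 ->
  is_derive p v ratio ((a * s p * u v - a * u p * (bilin p v / s p)) / Q p ^+ 2).
Proof.
move=> phi0 Q0.
have := is_derive_mul (is_derive_P v phi0) (is_derive_inv Q0 (is_derive_Q v phi0)).
move/is_derive_eq; apply; have s0 : s p != 0 by rewrite gt_eqF ?root_phi_gt0.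
by move: Q0; rewrite /P /Q => Q0; field; rewrite s0 Q0.
Qed.

Lemma is_derive_in (G H : TR R m -> R) p v d : D p -> {in D, G =1 H} ->
  is_derive p v H d -> is_derive p v G d.
Proof.
move=> Dp GH; apply: is_derive_near; apply: (near_eq_in D_open Dp) => q Dq.
by rewrite GH.
Qed.

Lemma domain_neq0 p : D p -> [/\ X p != 0, s p != 0, P p != 0 & Q p != 0].
Proof.
move=> Dp; have [_ phi0 P0 Q0] := (domainP p).1 Dp.
by split=> //; rewrite gt_eqF ?(conf_gt0 Dp) ?root_phi_gt0.
Qed.

Lemma is_derive_metricF p v : D p -> is_derive p v F
  (X' p * v.1 0 ord0 * (P p ^+ 2 / Q p) +
   X p * P p / Q p ^+ 2 * (a * (a * u p + 3 * s p) * u v + 2 * bilin p v)).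
Proof.
move=> Dp; have [Mp phi0 _ _] := (domainP p).1 Dp.
have [X0 s0 P0 Q0] := domain_neq0 Dp.
apply: (is_derive_in Dp (H := fun p => X p * (P p * P p * (Q p)^-1))).
  by move=> q /[!inE] Dq; rewrite metricF_domainE.
have dP := is_derive_P v phi0; have dQ := is_derive_Q v phi0.
have := is_derive_mul (is_derive_X v Mp)
  (is_derive_mul (is_derive_mul dP dP) (is_derive_inv Q0 dQ)).
move/is_derive_eq; apply; move: Q0; rewrite /P /Q => Q0; field.
by rewrite s0 Q0.
Qed.

Definition energy_dy h p : R := X p ^+ 2 * (ratio p ^+ 3 *
  (2 * a * (a * u p + 3 * s p) * del h + 4 * w p h)).

Lemma bilin_y p h : bilin p (0, delta_mx 0 h) = w p h.
Proof.
rewrite /bilin -[RHS](sum_delta (fun i => w p i)); apply: eq_bigr => k _.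
by rewrite mxE eqxx.
Qed.

Lemma w_y j k : w ((0, delta_mx 0 j) : TR R m) k = C j k.
Proof.
rewrite /polar extc_sym// -[RHS](sum_delta (C k)); apply: eq_bigr => l _.
by rewrite mxE eqxx.
Qed.
Lemma u_y h : u (0, delta_mx 0 h) = del h.
Proof. by rewrite /u mxE eqxx /delta1 eq_sym. Qed.

Lemma bilin_x p h : bilin p (delta_mx 0 h, 0) = 0.
Proof. by rewrite /bilin big1// => k _; rewrite [_ 0 k]mxE mulr0. Qed.

Lemma u_x h : u (delta_mx 0 h, 0) = 0.
Proof. by rewrite /u [LHS]mxE. Qed.

Lemma w_x h i : w ((delta_mx 0 h, 0) : TR R m) i = 0.
Proof. exact: polar_zero. Qed.

Lemma partial_y_metricF p h : D p ->
  partial_y h F p = X p * P p / Q p ^+ 2 *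
    (a * (a * u p + 3 * s p) * del h + 2 * w p h).
Proof.
move=> Dp; rewrite (partial_y_val (is_derive_metricF _ Dp)).
by rewrite bilin_y u_y /= mxE mulr0 mul0r add0r.
Qed.

Lemma is_derive_energy p v : D p -> is_derive p v (energy F)
  (2 * X p * X' p * v.1 0 ord0 * (P p ^+ 4 / Q p ^+ 2) +
   X p ^+ 2 * ratio p ^+ 3 * (2 * a * (a * u p + 3 * s p) * u v + 4 * bilin p v)).
Proof.
move=> Dp.
have [X0 s0 P0 Q0] := domain_neq0 Dp.
have dF := is_derive_metricF v Dp; have := is_derive_mul dF dF.
rewrite /energy; move/is_derive_eq; apply; rewrite metricF_domainE// /ratio; field.
by rewrite Q0.
Qed.

Lemma partial_y_energy p h : D p -> partial_y h (energy F) p = energy_dy h p.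
Proof.
move=> Dp; rewrite (partial_y_val (is_derive_energy _ Dp)).
by rewrite bilin_y u_y /= mxE mulr0 mul0r add0r /energy_dy mulrA.
Qed.

Lemma is_derive_energy_dy p v h : D p -> is_derive p v (partial_y h (energy F))
  (2 * X p * X' p * v.1 0 ord0 * (ratio p ^+ 3 *
     (2 * a * (a * u p + 3 * s p) * del h + 4 * w p h)) +
   X p ^+ 2 *
   (3 * ratio p ^+ 2 * ((a * s p * u v - a * u p * (bilin p v / s p)) / Q p ^+ 2) *
     (2 * a * (a * u p + 3 * s p) * del h + 4 * w p h) +
   ratio p ^+ 3 *
     (2 * a * (a * u v + 3 * (bilin p v / s p)) * del h + 4 * w v h))).
Proof.
move=> Dp; have [Mp phi0 _ _] := (domainP p).1 Dp.
have [X0 s0 P0 Q0] := domain_neq0 Dp.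
apply: (is_derive_in Dp (H := fun p => (X p * X p) * (ratio p * (ratio p * ratio p) *
    (2 * a * del h * (a * u p + 3 * s p) + 4 * w p h)))).
  by move=> q /[!inE] Dq; rewrite partial_y_energy// /energy_dy; ring.
have dX := is_derive_X v Mp; have dr := is_derive_ratio v phi0 Q0.
have ds := is_derive_s v phi0.
have := is_derive_mul (is_derive_mul dX dX)
  (is_derive_mul (is_derive_mul dr (is_derive_mul dr dr))
  (is_derive_add (is_derive_scale (2 * a * del h)
     (is_derive_add (is_derive_scale a (is_derive_u p v)) (is_derive_scale 3 ds)))
   (is_derive_scale 4 (is_derive_w p v h)))).
move/is_derive_eq; apply; field.
by rewrite s0 Q0.
Qed.

(** * The metric tensor and the spray *)

Notation gmx p := (metric_tensor F p).

Lemma metricE p i j : D p -> gmx p i j = 2^-1 * (X p ^+ 2 *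
   (3 * K p ^+ 2 * ((a * s p * del i - a * u p * (w p i / s p)) / Q p ^+ 2) *
     (2 * a * (a * u p + 3 * s p) * del j + 4 * w p j) +
   K p ^+ 3 * (2 * a * (a * del i + 3 * (w p i / s p)) * del j + 4 * C i j))).
Proof.
move=> Dp; rewrite mxE (partial_y_val (is_derive_energy_dy _ j Dp)).
rewrite bilin_y u_y w_y [(_, _).1]/= [const_mx _ _ _]mxE.
by congr (_ * _); ring.
Qed.

Lemma metric_mulr p (z : 'rV[R]_m.+1) i : D p ->
  \sum_j gmx p i j * z 0 j = 2^-1 * (X p ^+ 2 *
   (3 * K p ^+ 2 * ((a * s p * del i - a * u p * (w p i / s p)) / Q p ^+ 2) *
     (2 * a * (a * u p + 3 * s p) * z 0 ord0 + 4 * \sum_j w p j * z 0 j) +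
   K p ^+ 3 * (2 * a * (a * del i + 3 * (w p i / s p)) * z 0 ord0
     + 4 * polar c z i))).
Proof.
move=> Dp.
have -> : z 0 ord0 = \sum_j del j * z 0 j.
  by rewrite -[LHS](sum_delta (z 0)); apply: eq_bigr => j _; rewrite mulrC.
rewrite [polar c z i]/polar; set A := _ / Q p ^+ 2; set B := a * del i + _.
rewrite !mulr_sumr -!big_split /= !mulr_sumr -!big_split /= !mulr_sumr.
apply: eq_bigr => j _; rewrite metricE// -/A -/B. by ring.
Qed.

Lemma sum_polar_y p : 0 < phi c p.2 -> \sum_i w p i * p.2 0 i = s p ^+ 2.
Proof. by move=> phi0; rewrite sqr_root_phi// phi_polar. Qed.

Lemma metric_det0 p : a = 0 -> D p -> \det (gmx p) = 0.
Proof.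
move=> a0 Dp; rewrite (expand_det_row _ ord0) big1// => j _.
by rewrite metricE// polar0 extc0l a0 !(mul0r, mulr0, addr0, subr0).
Qed.

(** A kernel vector [z] is first paired with [y]: the rank one term drops out by
    homogeneity of [K] and the result says that the factor [T] of that same
    term is zero. *)
Lemma metric_det_neq0 p : a != 0 -> c \in unitmx -> D p -> \det (gmx p) != 0.
Proof.
move=> a0 cU Dp; have [Mp phi0 _ _] := (domainP p).1 Dp.
have [X0 s0 P0 Q0] := domain_neq0 Dp.
have K0 : K p != 0 by rewrite mulf_neq0 ?invr_eq0.
have c0 : 2^-1 * X p ^+ 2 * K p ^+ 3 != 0.
  by rewrite !mulf_neq0 ?expf_neq0 ?invr_eq0 ?pnatr_eq0.
rewrite -det_tr; apply/det0P => -[z z0 zg].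
have gz i : \sum_j gmx p i j * z 0 j = 0.
  have /rowP/(_ i) := zg; rewrite [LHS]mxE [RHS]mxE => zi; rewrite -[RHS]zi.
  by apply: eq_bigr => j _; rewrite [RHS]mulrC [_^T _ _]mxE.
set xi := z 0 ord0; set t := \sum_j w p j * z 0 j.
pose T := 2 * a * (a * u p + 3 * s p) * xi + 4 * t.
have T0 : T = 0.
  have : \sum_i (\sum_j gmx p i j * z 0 j) * p.2 0 i = 0.
    by rewrite big1// => i _; rewrite gz mul0r.
  have -> : \sum_i (\sum_j gmx p i j * z 0 j) * p.2 0 i =
    2^-1 * X p ^+ 2 * (
     (3 * K p ^+ 2 * a * s p / Q p ^+ 2 * T + K p ^+ 3 * 2 * a * a * xi)
     * (\sum_i p.2 0 i * del i) +
     (K p ^+ 3 * 2 * a * 3 * xi / s p - 3 * K p ^+ 2 * a * u p / s p / Q p ^+ 2 * T) *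
       (\sum_i w p i * p.2 0 i) +
     K p ^+ 3 * 4 * (\sum_i polar c z i * p.2 0 i)).
    rewrite !mulr_sumr -!big_split !mulr_sumr /=; apply: eq_bigr => i _.
    by rewrite metric_mulr// -/t -/xi -/T; field; rewrite s0 Q0.
  rewrite sum_delta -/(u p) sum_polar_y// polar_sym// -/t.
  rewrite (_ : _ * (_ + _ + _) = 2^-1 * X p ^+ 2 * K p ^+ 3 * T); last first.
    by rewrite /T; field; rewrite s0 Q0.
  by move=> /eqP; rewrite mulf_eq0 (negbTE c0) => /eqP.
have gz' i : 2 * a * (a * del i + 3 * (w p i / s p)) * xi + 4 * polar c z i = 0.
  have := gz i; rewrite metric_mulr// -/t -/xi -/T T0 mulr0 add0r.
  set E := _ + 4 * _; rewrite (_ : _ * _ = 2^-1 * X p ^+ 2 * K p ^+ 3 * E).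
    by move=> /eqP; rewrite mulf_eq0 (negbTE c0) => /eqP.
  by ring.
have xi0 : xi = 0.
  have := gz' ord0; rewrite !polar0 /delta1 eqxx mul0r !mulr0 !addr0 mulr1.
  by move=> /eqP; rewrite !mulf_eq0 pnatr_eq0/= (negbTE a0) => /eqP.
have z0' : z = 0.
  apply: (polar_inj c_sym cU xi0) => i; have := gz' i.
  by rewrite xi0 mulr0 add0r => /eqP; rewrite mulf_eq0 pnatr_eq0/= => /eqP.
by rewrite z0' eqxx in z0.
Qed.

Definition slope p : R := X' p / X p.

(** The claimed spray as a combination of [y] and the first axis, the two
    vectors on which the metric tensor acts simply. *)
Definition spray_vec p : 'rV[R]_m.+1 := \row_i (slope p *
  ((u p + 3 / (2 * a) * s p) * p.2 0 i - P p * Q p / (2 * a ^+ 2) * del i)).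

Lemma spray_polar p i : polar c (spray_vec p) i =
  slope p * (u p + 3 / (2 * a) * s p) * w p i.
Proof.
pose e : 'rV[R]_m.+1 := delta_mx 0 ord0.
have e0 : polar c e i = 0.
  rewrite /polar big1// => j _; rewrite mxE eqxx /=; case: eqP => [->|_].
    by rewrite extc0r mul0r.
  by rewrite mulr0.
have -> : spray_vec p = (slope p * (u p + 3 / (2 * a) * s p)) *: p.2 +
    ((- (slope p * (P p * Q p / (2 * a ^+ 2)))) *: e + 0).
  apply/rowP => j; rewrite !mxE eqxx /delta1 /=; ring.
by rewrite !polarD e0 polar_zero; ring.
Qed.

(** The right-hand side of the definition of the spray is [4 g G], so that
    [g^-1] never has to be computed. *)
Lemma spray_coefE p i : a != 0 -> c \in unitmx -> D p ->
  spray_coef F i p = spray_vec p 0 i.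
Proof.
move=> a0 cU Dp; have [Mp phi0 _ _] := (domainP p).1 Dp.
have [X0 s0 P0 Q0] := domain_neq0 Dp.
have gU : gmx p \in unitmx by rewrite unitmxE unitfE metric_det_neq0.
have N h : \sum_r p.2 0 r * partial_x r (partial_y h (energy F)) p
     - partial_x h (energy F) p = 4 * \sum_k gmx p h k * spray_vec p 0 k.
  have px r : partial_x r (partial_y h (energy F)) p =
     2 * X p * X' p * K p ^+ 3 * 
      (2 * a * (a * u p + 3 * s p) * del h + 4 * w p h) * del r.
    rewrite (partial_x_val (is_derive_energy_dy _ h Dp)) bilin_x u_x w_x.
    by rewrite /= mxE eqxx /delta1 [_ == r]eq_sym /=; ring.
  have -> : \sum_r p.2 0 r * partial_x r (partial_y h (energy F)) p =
     2 * X p * X' p * K p ^+ 3 *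
      (2 * a * (a * u p + 3 * s p) * del h + 4 * w p h) * u p.
    have uE : u p = \sum_k p.2 0 k * del k by rewrite sum_delta.
    rewrite [X in _ = _ * X]uE mulr_sumr; apply: eq_bigr => k _.
    by rewrite px /delta1; ring.
  have -> : partial_x h (energy F) p =
      2 * X p * X' p * (P p ^+ 4 / Q p ^+ 2) * del h.
    rewrite (partial_x_val (is_derive_energy _ Dp)) bilin_x u_x.
    by rewrite /= mxE eqxx /delta1 [_ == h]eq_sym /=; ring.
  rewrite metric_mulr// spray_polar//.
  have -> : \sum_j w p j * spray_vec p 0 j =
      slope p * (u p + 3 / (2 * a) * s p) * s p ^+ 2.
    rewrite polar_sym// -sum_polar_y// mulr_sumr; apply: eq_bigr => k _.
    by rewrite spray_polar mulrA.
  rewrite mxE -/(u p) /delta1 eqxx mulr1 /slope /ratio.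
  move: P0 Q0; rewrite /P /Q => P0 Q0; field.

  by rewrite a0 X0 s0 Q0.
rewrite /spray_coef; under eq_bigr do rewrite N mulrCA.
rewrite -mulr_sumr mulrA mulVf ?pnatr_eq0// mul1r.
transitivity ((invmx (gmx p) *m (gmx p *m (spray_vec p)^T)) i 0).
  rewrite [RHS]mxE; apply: eq_bigr => h _; congr (_ * _).
  by rewrite [RHS]mxE; apply: eq_bigr => k _; congr (_ * _); rewrite [RHS]mxE.
by rewrite mulKmx// mxE.
Qed.

(** * Third derivatives of the spray *)

(** The projection of the direction to the hyperplane [y^1 = 0]. *)
Definition transv v h : R := v.2 0 h - del h * u v.

Lemma is_derive_transv p v h : is_derive p v (fun q => transv q h) (transv v h).
Proof. by apply: is_derive_lin => t q; rewrite /transv /u /= !mxE; ring. Qed.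

Lemma is_derive_slope p k : D p -> is_derive p (0, delta_mx 0 k) slope 0.
Proof.
move=> Dp; have [Mp _ _ _] := (domainP p).1 Dp.
have [X0 _ _ _] := domain_neq0 Dp.
have df : derivable (derive1 f) (p.1 0 ord0) 1 := @f_smooth _ Mp 1.
have dX' := is_derive_comp1 df (is_derive_x ord0 p (0, delta_mx 0 k)).
have := is_derive_mul dX' (is_derive_inv X0 (is_derive_X _ Mp)).
by move/is_derive_eq; apply; rewrite /= mxE !mulr0 oppr0 !mul0r mulr0 addr0.
Qed.

(** The second derivatives of [s = sqrt phi], and below the third ones: the
    identity [(s^2)_ijk = 0] expresses [s_ijk] through [s_ij] and [w]. *)
Definition rootH j k p : R := C j k / s p - w p j * w p k / s p ^+ 3.

Definition spray_dy h k p : R := slope p *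
  (3 / (2 * a) * (w p k * (s p)^-1 * transv p h + s p * transv (0, delta_mx 0 k) h) +
   (del k * p.2 0 h + (h == k)%:R * u p
     + - del h * (del k * u p + 2 / a ^+ 2 * w p k))).

Definition spray_dyy h j k p : R := slope p *
  (3 / (2 * a) * (rootH j k p * transv p h
      + w p k * (s p)^-1 * transv (0, delta_mx 0 j) h
      + w p j * (s p)^-1 * transv (0, delta_mx 0 k) h) +
   (del k * (h == j)%:R + (h == k)%:R * del j
     - del h * (del k * del j + 2 / a ^+ 2 * C j k))).

Definition rootT i j k p : R :=
  - (rootH i j p * w p k + rootH j k p * w p i + rootH i k p * w p j) / s p ^+ 2.

Definition spray_dyyy h i j k p : R := slope p * (3 / (2 * a) *
  (rootT i j k p * transv p h + rootH j k p * transv (0, delta_mx 0 i) h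
   + rootH i k p * transv (0, delta_mx 0 j) h
   + rootH i j p * transv (0, delta_mx 0 k) h)).

Hypotheses (a_neq0 : a != 0) (c_unit : c \in unitmx).

(** The product [u s] hidden in [P Q] turns [s y^h] into [s * transv], the only
    irrational term of the spray; the rest is a quadratic polynomial in [y],
    which three derivatives annihilate. *)
Lemma spray_coef_y h k p : D p -> partial_y k (spray_coef F h) p = spray_dy h k p.
Proof.
move=> Dp; have [Mp phi0 _ _] := (domainP p).1 Dp.
have [X0 s0 P0 Q0] := domain_neq0 Dp.
apply: partial_y_val.
apply: (is_derive_in Dp (H := fun q => slope q * (3 / (2 * a) * (s q * transv q h) +
   (u q * q.2 0 h + - del h * (2^-1 * (u q * u q) + 1 / a ^+ 2 * phi c q.2))))).
  move=> q /[!inE] Dq; have [_ phi1 _ _] := (domainP q).1 Dq.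
  by rewrite spray_coefE// mxE /transv /P /Q -sqr_root_phi//; field.
have ds := is_derive_s (0, delta_mx 0 k) phi0.
have du := is_derive_u p (0, delta_mx 0 k).
have := is_derive_mul (is_derive_slope k Dp)
  (is_derive_add (is_derive_scale (3 / (2 * a))
     (is_derive_mul ds (is_derive_transv _ _ h)))
    (is_derive_add (is_derive_mul du (is_derive_y h p _))
       (is_derive_scale (- del h)
         (is_derive_add (is_derive_scale 2^-1 (is_derive_mul du du))
         (is_derive_scale (1 / a ^+ 2) (is_derive_phi _ _)))))).
move/is_derive_eq; apply; rewrite bilin_y u_y /spray_dy /= mxE eqxx /=.
field.
by rewrite a_neq0 s0.
Qed.

Lemma is_derive_root_phiV p v : 0 < phi c p.2 ->
  is_derive p v (fun q => (s q)^-1) (- bilin p v / s p ^+ 3).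
Proof.
move=> phi0; have s0 : s p != 0 by rewrite gt_eqF ?root_phi_gt0.
have := is_derive_inv s0 (is_derive_s v phi0); move/is_derive_eq; apply.
by field.
Qed.

Lemma spray_coef_yy h j k p : D p ->
  partial_y j (partial_y k (spray_coef F h)) p = spray_dyy h j k p.
Proof.
move=> Dp; have [Mp phi0 _ _] := (domainP p).1 Dp.
have [X0 s0 P0 Q0] := domain_neq0 Dp.
apply: partial_y_val.
apply: (is_derive_in Dp (H := spray_dy h k)).
  by move=> q /[!inE] Dq; rewrite spray_coef_y.
have ds := is_derive_s (0, delta_mx 0 j) phi0.
have dsV := is_derive_root_phiV (0, delta_mx 0 j) phi0.
have du := is_derive_u p (0, delta_mx 0 j).
have dw := is_derive_w p (0, delta_mx 0 j) k.
have := is_derive_mul (is_derive_slope j Dp)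
  (is_derive_add (is_derive_scale (3 / (2 * a))
     (is_derive_add (is_derive_mul (is_derive_mul dw dsV) (is_derive_transv _ _ h))
        (is_derive_mul ds (is_derive_cst (transv (0, delta_mx 0 k) h : R) _ _))))
    (is_derive_add (is_derive_add (is_derive_scale (del k) (is_derive_y h p _))
         (is_derive_scale (h == k)%:R du))
       (is_derive_scale (- del h) (is_derive_add (is_derive_scale (del k) du)
         (is_derive_scale (2 / a ^+ 2) dw))))).
move/is_derive_eq; apply; rewrite bilin_y u_y w_y /spray_dyy /rootH /=.
rewrite [delta_mx _ _ 0 h]mxE eqxx /=.
field.
by rewrite a_neq0 s0.
Qed.

Lemma is_derive_rootH i j k p : 0 < phi c p.2 ->
  is_derive p (0, delta_mx 0 i) (rootH j k) (rootT i j k p).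
Proof.
move=> phi0; have s0 : s p != 0 by rewrite gt_eqF ?root_phi_gt0.
(* The expansion also holds where [s] vanishes, as the inverse of zero is zero;
   hence an equality of functions. *)
rewrite (_ : rootH j k = fun q => C j k * (s q)^-1 + (- 1) *
  ((w q j * w q k) * ((s q)^-1 * ((s q)^-1 * (s q)^-1)))); last first.
  apply/funext => q; rewrite /rootH.
  have [->|sq] := eqVneq (s q) 0; last by field.
  by rewrite expr0n invr0 !mulr0 subrr addr0.
have dsV := is_derive_root_phiV (0, delta_mx 0 i) phi0.
have dw l := is_derive_w p (0, delta_mx 0 i) l.
have := is_derive_add (is_derive_scale (C j k) dsV) (is_derive_scale (- 1)
  (is_derive_mul (is_derive_mul (dw j) (dw k))
    (is_derive_mul dsV (is_derive_mul dsV dsV)))).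
move/is_derive_eq; apply; rewrite bilin_y !w_y /rootT /rootH.
field.
by [].
Qed.

Lemma spray_coef_yyy h i j k p : D p ->
  berwald_tensor F h i j k p = spray_dyyy h i j k p.
Proof.
move=> Dp; have [Mp phi0 _ _] := (domainP p).1 Dp.
have [X0 s0 P0 Q0] := domain_neq0 Dp.
apply: partial_y_val.
apply: (is_derive_in Dp (H := spray_dyy h j k)).
  by move=> q /[!inE] Dq; rewrite spray_coef_yy.
have dsV := is_derive_root_phiV (0, delta_mx 0 i) phi0.
have dw l := is_derive_w p (0, delta_mx 0 i) l.
have cst r : is_derive p ((0, delta_mx 0 i) : TR R m) (fun=> r : R) 0.
  exact: is_derive_cst.
have := is_derive_mul (is_derive_slope i Dp)
  (is_derive_add (is_derive_scale (3 / (2 * a))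
     (is_derive_add (is_derive_add
         (is_derive_mul (is_derive_rootH i j k phi0) (is_derive_transv _ _ h))
         (is_derive_mul (is_derive_mul (dw k) dsV) (cst (transv (0, delta_mx 0 j) h))))
        (is_derive_mul (is_derive_mul (dw j) dsV) (cst (transv (0, delta_mx 0 k) h)))))
    (cst (del k * (h == j)%:R + (h == k)%:R * del j
     - del h * (del k * del j + 2 / a ^+ 2 * C j k)))).
move/is_derive_eq; apply; rewrite bilin_y !w_y /spray_dyyy /rootH /=.
field.
by rewrite a_neq0 s0.
Qed.

(** * The Landsberg and Berwald tensors *)

Lemma del_transv v h : del h * transv v h = 0.
Proof.
rewrite /transv /delta1; case: eqP => [->|_]; last by rewrite mul0r.
by rewrite /u /=; ring.
Qed.

Lemma sum_polar_transv p v : \sum_h w p h * transv v h = bilin p v.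
Proof.
apply: eq_bigr => h _; rewrite /transv /delta1; case: eqP => [->|_].
  by rewrite polar0 !mul0r.
by rewrite mul0r subr0.
Qed.

(** By [del_transv] the gradient of [F] pairs with transverse vectors like a
    multiple of [w]; then [w] contracts the third derivatives of [s * transv]
    to [s^2 s_ijk + w_i s_jk + w_j s_ik + w_k s_ij], which is zero by the
    definition of [rootT]. *)
Lemma metricF_landsberg : is_landsberg D F.
Proof.
move=> p Dp i j k; have [_ phi0 _ _] := (domainP p).1 Dp.
have [X0 s0 P0 Q0] := domain_neq0 Dp.
rewrite /landsberg_tensor.
have contract v : \sum_h partial_y h F p * transv v h =
    X p * P p / Q p ^+ 2 * (2 * bilin p v).
  rewrite -sum_polar_transv !mulr_sumr; apply: eq_bigr => h _.
  rewrite partial_y_metricF// -mulrA; congr (_ * _).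
  by rewrite mulrDl -[_ * del h * _]mulrA del_transv mulr0 add0r mulrA.
have -> : \sum_h partial_y h F p * berwald_tensor F h i j k p =
    slope p * (3 / (2 * a)) * (rootT i j k p * (\sum_h partial_y h F p * transv p h)
   + rootH j k p * (\sum_h partial_y h F p * transv (0, delta_mx 0 i) h)
   + rootH i k p * (\sum_h partial_y h F p * transv (0, delta_mx 0 j) h)
   + rootH i j p * (\sum_h partial_y h F p * transv (0, delta_mx 0 k) h)).
  rewrite !mulr_sumr -!big_split mulr_sumr; apply: eq_bigr => h _ /=.
  by rewrite spray_coef_yyy// /spray_dyyy; ring.
rewrite !contract !bilin_y {1}/bilin sum_polar_y// /rootT.
field.
by rewrite a_neq0 s0 Q0.
Qed.

Lemma sum_extc_transv p v j : \sum_h C h j * transv v h = w v j.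
Proof.
rewrite /polar; apply: eq_bigr => h _; rewrite /transv /delta1 extc_sym//.
by case: eqP => [->|_]; [rewrite extc0r !mul0r|rewrite mul0r subr0].
Qed.

(** For [v] the direction [y] itself, both terms on the right are [w_j / s]:
    this is the homogeneity of [s]. *)
Lemma sum_rootH_transv p v j : 0 < phi c p.2 ->
  \sum_h rootH h j p * transv v h = w v j / s p - bilin p v * w p j / s p ^+ 3.
Proof.
move=> phi0; rewrite -(sum_extc_transv p) -sum_polar_transv !mulr_suml -sumrB.
apply: eq_bigr => h _; rewrite /rootH; field.
by rewrite gt_eqF ?root_phi_gt0.
Qed.

Lemma sum_transv_diag : \sum_h transv (0, delta_mx 0 h) h = m%:R.
Proof.
rewrite (eq_bigr (fun h => if h == ord0 then 0 else 1)); last first.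
  move=> h _; rewrite /transv u_y /= mxE !eqxx /delta1.
  by case: eqP => _ /=; ring.
by rewrite big_ord_recl/= add0r sumr_const card_ord.
Qed.

(** The factor [n] is [m - 1 + 2]: the trace of the projection is [m], the third
    derivatives of [s] contribute [- 1] and the two remaining terms [1] each. *)
Lemma berwald_trace p j k : D p ->
  \sum_h berwald_tensor F h h j k p =
  slope p * (3 / (2 * a)) * (m.+1%:R * rootH j k p).
Proof.
move=> Dp; have [_ phi0 _ _] := (domainP p).1 Dp.
have [X0 s0 P0 Q0] := domain_neq0 Dp.
transitivity (slope p * (3 / (2 * a)) * (
  - ((\sum_h rootH h j p * transv p h) * w p k
     + rootH j k p * (\sum_h w p h * transv p h)
     + (\sum_h rootH h k p * transv p h) * w p j) / s p ^+ 2
  + rootH j k p * (\sum_h transv (0, delta_mx 0 h) h)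
  + \sum_h rootH h k p * transv (0, delta_mx 0 j) h
  + \sum_h rootH h j p * transv (0, delta_mx 0 k) h)).
  rewrite !(mulr_suml, mulr_sumr) -!big_split -sumrN mulr_suml -!big_split mulr_sumr.
  by apply: eq_bigr => h _ /=; rewrite spray_coef_yyy// /spray_dyyy /rootT; ring.
rewrite !sum_rootH_transv// sum_polar_transv sum_transv_diag.
rewrite !bilin_y !w_y {1 2 3}/bilin sum_polar_y// -natr1.
rewrite (extc_sym c_sym k j) /rootH; field.
by rewrite a_neq0 s0.
Qed.

(** If the Hessian of [s] vanished, [C] would equal [w w^T / s^2], and a vector
    with zero first coordinate orthogonal to [w] would be zero.  Two coordinates
    suffice to produce a nonzero one. *)
Lemma rootH_neq0 p : (1 < m)%N -> 0 < phi c p.2 -> exists j k, rootH j k p != 0.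
Proof.
move=> m1 phi0; have s0 : s p != 0 by rewrite gt_eqF ?root_phi_gt0.
apply: contrapT => norootH.
have CE j k : C j k = w p j * w p k / s p ^+ 2.
  have : rootH j k p = 0.
    by apply: contrapT => /eqP ljk; apply: norootH; exists j, k.
  move=> /(congr1 ( *%R (s p))); rewrite mulr0 /rootH => e.
  apply/eqP; rewrite -subr_eq0; apply/eqP; rewrite -e; field.
  by rewrite s0.
pose j1 : 'I_m := Ordinal (ltnW m1); pose j2 : 'I_m := Ordinal m1.
have orth (z : 'rV[R]_m.+1) : z 0 ord0 = 0 -> \sum_j w p j * z 0 j = 0 -> z = 0.
  move=> z0 wz; apply: (polar_inj c_sym c_unit z0) => i.
  rewrite -[RHS](mulr0 (w p i / s p ^+ 2)) -wz mulr_sumr.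
  by apply: eq_bigr => j _; rewrite CE; ring.
pose l1 := lift ord0 j1; pose l2 := lift ord0 j2.
have l12 : l2 != l1 by [].
pose z : 'rV[R]_m.+1 := w p l2 *: delta_mx 0 l1 - w p l1 *: delta_mx 0 l2.
have wz x y : \sum_j w p j * (x *: delta_mx 0 l1 - y *: delta_mx 0 l2 : 'rV_m.+1) 0 j =
    x * w p l1 - y * w p l2.
  rewrite -(sum_delta (fun i => w p i) l1) -(sum_delta (fun i => w p i) l2).
  rewrite !mulr_sumr -sumrB; apply: eq_bigr => j _; rewrite !mxE eqxx /=; ring.
have z0 : z = 0.
  by apply: orth; [rewrite !mxE !mulr0 subr0|rewrite wz mulrC subrr].
have w1 : w p l1 = 0.
  have /rowP/(_ l2) := z0; rewrite !mxE !eqxx (negbTE l12) mulr0 mulr1 sub0r => /eqP.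
  by rewrite oppr_eq0 => /eqP.
have : (1 *: delta_mx 0 l1 - 0 *: delta_mx 0 l2 : 'rV[R]_m.+1) = 0.
  by apply: orth; [rewrite !mxE !mulr0 subr0|rewrite wz w1 mulr0 mul0r subr0].
move=> /rowP/(_ l1); rewrite !mxE !eqxx mul0r subr0 mulr1 => /eqP.
by rewrite oner_eq0.
Qed.

Lemma metricF_not_berwald : (1 < m)%N ->
  (exists x, M x /\ derive1 f (x 0 ord0) != 0) -> (exists y, 0 < phi c y) ->
  ~ is_berwald D F.
Proof.
move=> m1 [x [Mx fx]] [y phiy] Fb.
(* Moving the direction to [y^1 = 0] keeps [phi], and there [a u + s] and
   [a u + 2 s] are multiples of [s]. *)
pose y0 : 'rV[R]_m.+1 := \row_i if i == ord0 then 0 else y 0 i.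
have phi0 : 0 < phi c y0.
  rewrite (_ : phi c y0 = phi c y)//; apply: eq_bigr => i _; apply: eq_bigr => j _.
  by rewrite !mxE.
pose p : TR R m := (x, y0).
have u0 : u p = 0 by rewrite /u mxE.
have Dp : D p.
  apply/domainP; rewrite /P /Q u0 mulr0 !add0r.
  by split=> //; rewrite ?mulf_neq0 ?pnatr_eq0// gt_eqF ?root_phi_gt0.
have [X0 s0 _ _] := domain_neq0 Dp.
have [j [k ljk]] := rootH_neq0 m1 (phi0 : 0 < phi c p.2).
have : slope p * (3 / (2 * a)) * (m.+1%:R * rootH j k p) != 0.
  rewrite !mulf_neq0 ?invr_neq0 ?pnatr_eq0//.
  by rewrite mulf_neq0 ?pnatr_eq0.
by rewrite -berwald_trace// big1 ?eqxx// => h _; exact: Fb.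
Qed.

Lemma spray_coef_first p : D p -> spray_coef F ord0 p = sprayG1 f c a p.
Proof.
move=> Dp; have [Mp phi0 _ _] := (domainP p).1 Dp.
have [X0 s0 P0 Q0] := domain_neq0 Dp.
have ab := alphaBbeta (conf_gt0 Dp) phi0.
have al : alpha f c p ^+ 2 = (X p * s p) ^+ 2 + (X p * u p) ^+ 2.
  by rewrite -ab subrK.
rewrite spray_coefE// mxE /sprayG1 ab al -/(u p) -/(X p) -/(X' p) /slope /P /Q.
by rewrite /delta1 eqxx mulr1n; field; rewrite a_neq0 X0.
Qed.

Lemma spray_coef_lift p mu : D p ->
  spray_coef F (lift ord0 mu) p = sprayP f c a p * p.2 0 (lift ord0 mu).
Proof.
move=> Dp; have [Mp phi0 _ _] := (domainP p).1 Dp.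
have [X0 s0 P0 Q0] := domain_neq0 Dp.
rewrite spray_coefE// mxE /sprayP (sqrt_alphaBbeta (conf_gt0 Dp) phi0).
rewrite -/(u p) -/(X p) -/(X' p) /slope /delta1 /=.
by field; rewrite a_neq0 X0.
Qed.

Lemma metricF_finsler : finsler_metric M D F.
Proof.
split=> [|p Dp|x y t||p Dp].
- exact: D_open.
- by case: Dp.
- exact: metricF_homogeneous.
- exact: metricF_smooth.
- by split; [case: Dp|exact: metric_det_neq0].
Qed.

End Example.

(** * The Landsberg metric that is not Berwald *)

Unset Implicit Arguments.

Theorem theorem4p10 (R : realType) (m : nat) (hn : (3 <= m.+1)%N)
    (M : set 'rV[R]_m.+1) (M_open : open M)
    (f : R -> R)
    (f_smooth : forall x, M x -> forall k : nat, derivable (derive1n k f) (x 0 ord0) 1)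
    (f_pos : forall x, M x -> 0 < f (x 0 ord0))
    (f_nonconst : exists x, M x /\ derive1 f (x 0 ord0) != 0)
    (c : 'M[R]_m) (c_sym : c^T = c) (c_nonsing : c \in unitmx)
    (phi_pos : exists y, 0 < phi c y)
    (a : R) :
  let F := metricF f c a in
  let D := metricF_domain f c a M in
  (a != 0 ->
    [/\ finsler_metric M D F,
        is_landsberg D F,
        ~ is_berwald D F
      & forall p, D p ->
          spray_coef F ord0 p = sprayG1 f c a p /\
          (forall mu : 'I_m,
             spray_coef F (lift ord0 mu) p
             = sprayP f c a p * p.2 0 (lift ord0 mu))]) /\
  (a = 0 -> forall p, D p -> \det (metric_tensor F p) = 0).
Proof.
move=> F D; split=> [a0|a0 p Dp]; last by apply: (metric_det0 (M := M)).
split.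
- by apply: metricF_finsler.
- by apply: metricF_landsberg.
- by apply: metricF_not_berwald.
- move=> p Dp; split=> [|mu]; first by apply: (spray_coef_first (M := M)).
  by apply: (spray_coef_lift (M := M)).
Qed.
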